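(* Let $\gamma:I\to M^2$ be a PA curve in a connected orientable Riemannian surface $M^2$ with $(\mathcal V,\theta)$, where $\mathcal V$ is a torse-forming vector field along $\gamma$ with potential function $f$, not parallel along $\gamma$, $\mathcal V=\sin\theta\,T+\cos\theta\,N$, and $\cos\theta=\kappa$, with $\kappa$ the curvature of $\gamma$. Then, up to an integration constant, $$\kappa(s)=\operatorname{sech}\left(s+\int^s f(u)\,du\right),$$ i.e. the formula holds for all $s\in I$ for a suitable antiderivative $\int^sf(u)\,du$ of $f$.
   Context: $\nabla$ is the Levi-Civita connection, $I\subset\mathbb R$ an interval, $s\in I$ arc length. Frenet curve in a surface: a smooth curve $\gamma:I\to M^2$ with $\gamma',\nabla_{\gamma'}\gamma'$ linearly independent along $I$. When parametrized by arc length it has a positively oriented orthonormal Frenet frame $\{T=\gamma',N\}$ and curvature $\kappa>0$ with $\nabla_TT=\kappa N$, $\nabla_TN=-\kappa T$. Torse-forming along $\gamma$: $\mathcal V$ is torse-forming along $\gamma$ with potential function $f$ and generating form $\omega$ if $\nabla_T\mathcal V=fT+\omega(T)\mathcal V$, where $f,\omega(T)$ are smooth functions on $I$. Parallel along $\gamma$ means $\nabla_T\mathcal V=0$ identically. PA (prescribed angle) curve: an arc length parametrized Frenet curve $\gamma$ is a PA curve with $(\mathcal V,\theta)$, where $\mathcal V$ is a nowhere zero vector field along $\gamma$ and $\theta:I\to[0,\pi]$ is smooth, if $\mathcal V$ has unit length along $\gamma$ and $\cos\theta=\langle\mathcal V,N\rangle$. Throughout the study of PA curves in surfaces, $\mathcal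 V$ is written as $\mathcal V=\sin\theta\,T+\cos\theta\,N$. *)

(* Defs.v *)
From HB Require Import structures.
From mathcomp Require Export all_boot all_order all_algebra.
From mathcomp Require Export all_classical all_reals all_analysis.
Set Implicit Arguments.
Unset Strict Implicit.
Unset Printing Implicit Defensive.
Export Order.TTheory GRing.Theory Num.Theory.
Export numFieldNormedType.Exports.
Local Open Scope classical_set_scope.
Local Open Scope ring_scope.

(** * Smooth functions *)

Section SmoothOnReals.
Context {R : realType} {V : normedModType R}.
Implicit Types (A : set R) (f : R -> V) (s : R).

(* The increment h is restricted to s + h \in A: the derivative is one-sided at
   an endpoint of an interval A, and depends only on the values of f on A. *)
Definition is_deriv_within A f s (l : V) : Prop :=
  (h^-1 *: (f (s + h) - f s)) @[h --> within [set h | A (s + h)] 0^'] --> l.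

Definition derivable_within A f s : Prop :=
  cvg ((h^-1 *: (f (s + h) - f s)) @[h --> within [set h | A (s + h)] 0^']).

Definition deriv_within A f s : V :=
  lim ((h^-1 *: (f (s + h) - f s)) @[h --> within [set h | A (s + h)] 0^']).

Fixpoint Ck_within (k : nat) A f : Prop :=
  if k is k'.+1 then
    (forall s, A s -> derivable_within A f s) /\
    Ck_within k' A (deriv_within A f)
  else {within A, continuous f}.

Definition smooth_within A f : Prop := forall k, Ck_within k A f.

End SmoothOnReals.

Section SmoothOnPlane.
Context {R : realType} {V : normedModType R}.

Definition partial (i : 'I_2) (f : 'rV[R]_2 -> V) (x : 'rV[R]_2) : V :=
  'D_(delta_mx 0 i) f x.

(* Used only for an open set U. *)
Fixpoint Ck_plane (k : nat) (U : set 'rV[R]_2) (f : 'rV[R]_2 -> V) : Prop :=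
  if k is k'.+1 then
    [/\ {within U, continuous f},
        forall x i, U x -> derivable f x (delta_mx 0 i) &
        forall i, Ck_plane k' U (partial i f)]
  else {within U, continuous f}.

Definition smooth_plane (U : set 'rV[R]_2) (f : 'rV[R]_2 -> V) : Prop :=
  forall k, Ck_plane k U f.

End SmoothOnPlane.

(** * Oriented Riemannian surfaces *)

(* [param c] is the inverse of the homeomorphism [coord c] from the open set
   [dom c] onto the open set [coord c @` dom c]; both maps carry arbitrary
   values elsewhere. *)
Record atlas (R : realType) (M : topologicalType) := Atlas {
  chart : Type ;
  dom : chart -> set M ;
  coord : chart -> M -> 'rV[R]_2 ;
  param : chart -> 'rV[R]_2 -> M ;
  dom_open : forall c, open (dom c) ;
  dom_cover : forall p, exists c, dom c p ;
  image_open : forall c, open (coord c @` dom c) ;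
  coord_continuous : forall c, {within dom c, continuous (coord c)} ;
  param_continuous :
    forall c, {within coord c @` dom c, continuous (param c)} ;
  coordK : forall c p, dom c p -> param c (coord c p) = p ;
  transition_smooth : forall c d,
    smooth_plane (coord c @` (dom c `&` dom d)) (coord d \o param c)
}.
Arguments dom {R M a}.
Arguments coord {R M a}.
Arguments param {R M a}.

Section Surface.
Context {R : realType} {M : topologicalType} (S : atlas R M).
Implicit Types (c d : chart S) (p : M).

(* As in [jacobian], matrices act on row vectors from the right: the components
   of a tangent vector at p in the charts c and d satisfy
   v_d = v_c *m jac c d p. *)
Definition jac c d p : 'M[R]_2 := 'J (coord d \o param c) (coord c p).

(* The entries of [metric c x] are the g_ij of the chart c at the point of
   coordinates x. *)
Record riemannian_metric := RiemannianMetric {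
  metric : chart S -> 'rV[R]_2 -> 'M[R]_2 ;
  metric_smooth : forall c i j,
    smooth_plane (coord c @` dom c) (fun x => metric c x i j) ;
  metric_sym : forall c p, dom c p ->
    (metric c (coord c p))^T = metric c (coord c p) ;
  metric_pos : forall c p (v : 'rV[R]_2), dom c p -> v != 0 ->
    0 < (v *m metric c (coord c p) *m v^T) 0 0 ;
  metric_change : forall c d p, dom c p -> dom d p ->
    metric c (coord c p) =
    jac c d p *m metric d (coord d p) *m (jac c d p)^T
}.

(* A continuous choice, at each point of each chart domain, of a sign telling
   whether the coordinate basis of the chart is positively oriented. *)
Record orientation := Orientation {
  orient : chart S -> M -> R ;
  orient_sign : forall c p, dom c p -> orient c p = 1 \/ orient c p = -1 ;
  orient_continuous : forall c, {within dom c, continuous (orient c)} ;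
  orient_change : forall c d p, dom c p -> dom d p ->
    orient d p = Num.sg (\det (jac c d p)) * orient c p
}.

(* Christoffel symbols of the second kind: the component along e_k of the
   Levi-Civita derivative of e_j in the direction e_i. *)
Definition christoffel (g : riemannian_metric) c (k i j : 'I_2)
    (x : 'rV[R]_2) : R :=
  2^-1 * \sum_l invmx (metric g c x) k l *
    (partial i (fun y => metric g c y j l) x
     + partial j (fun y => metric g c y i l) x
     - partial l (fun y => metric g c y i j) x).

(** * Fields along a curve *)

(* A vector field along gamma is the family of its components X c s at gamma s
   in the charts c; only the values with [dom c (gamma s)] are meaningful. *)
Definition along := chart S -> R -> 'rV[R]_2.

Variables (g : riemannian_metric) (o : orientation).
Variables (I : set R) (gamma : R -> M).
Implicit Types (X Y T N V : along).

Definition times c : set R := [set s | I s /\ dom c (gamma s)].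

Definition smooth_curve : Prop :=
  {within I, continuous gamma} /\
  forall c, smooth_within (times c) (coord c \o gamma).

Definition vector_field_along X : Prop :=
  (forall c, smooth_within (times c) (X c)) /\
  (forall c d s, times c s -> times d s ->
     X d s = X c s *m jac c d (gamma s)).

Definition velocity : along :=
  fun c s => deriv_within I (coord c \o gamma) s.

Definition inner c s X Y : R :=
  (X c s *m metric g c (coord c (gamma s)) *m (Y c s)^T) 0 0.

Definition unit_along X : Prop := forall c s, times c s -> inner c s X X = 1.

(* Covariant derivative along gamma for the Levi-Civita connection of g, in
   the direction of the velocity of gamma. *)
Definition nabla X : along := fun c s =>
  deriv_within I (X c) s +
  \row_k \sum_i \sum_j christoffel g c k i j (coord c (gamma s))
                       * velocity c s 0 i * X c s 0 j.

Definition parallel_along X : Prop := forall c s, times c s -> nabla X c s = 0.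

(* A one-form along gamma, as the family of its components in the charts. *)
Definition form_along := chart S -> R -> 'cV[R]_2.

Definition one_form_along (w : form_along) : Prop :=
  forall c d s, times c s -> times d s ->
    w c s = jac c d (gamma s) *m w d s.

Definition eval_form (w : form_along) X c s : R := (X c s *m w c s) 0 0.

Definition torse_forming V (f : R -> R) (w : form_along) : Prop :=
  [/\ smooth_within I f,
      one_form_along w,
      forall c, smooth_within (times c) (eval_form w velocity c) &
      forall c s, times c s ->
        nabla V c s =
        f s *: velocity c s + eval_form w velocity c s *: V c s].

(** * Frenet curves and prescribed angle curves *)

Definition frenet_curve : Prop :=
  smooth_curve /\
  forall c s, times c s ->
    row_free (col_mx (velocity c s) (nabla velocity c s)).

Definition arc_length : Prop := unit_along velocity.

(* T is the velocity of gamma. *)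
Definition frenet_frame N (kappa : R -> R) : Prop :=
  let T := velocity in
  [/\ vector_field_along N,
      forall c s, times c s ->
        [/\ inner c s T T = 1, inner c s N N = 1 & inner c s T N = 0],
      forall c s, times c s ->
        0 < orient o c (gamma s) * \det (col_mx (T c s) (N c s)),
      forall s, I s -> 0 < kappa s &
      forall c s, times c s ->
        nabla T c s = kappa s *: N c s /\
        nabla N c s = - kappa s *: T c s].

Definition PA_curve N V (theta : R -> R) : Prop :=
  [/\ frenet_curve /\ arc_length,
      vector_field_along V /\ (forall c s, times c s -> V c s != 0),
      smooth_within I theta /\ (forall s, I s -> 0 <= theta s <= pi),
      unit_along V &
      forall c s, times c s -> cos (theta s) = inner c s V N].

End Surface.

(* Without the second clause I could be empty or a single point, where
   derivatives within I are meaningless. *)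
Definition nondegenerate_interval (R : realType) (I : set R) : Prop :=
  is_interval I /\ exists a b, [/\ I a, I b & a < b].

Definition sech (R : realType) (x : R) : R := 2 / (expR x + expR (- x)).

(* Main.v *)
Require Import Defs.
From mathcomp Require Import ring lra.
Set Implicit Arguments.
Unset Strict Implicit.
Unset Printing Implicit Defensive.
Local Open Scope classical_set_scope.
Local Open Scope ring_scope.

(** Differentiating [V = sin theta T + cos theta N] with the Frenet equations
    gives
      [nabla V = (theta' - kappa) (cos theta T - sin theta N)],
    a multiple of the unit normal of [V].  The torse-forming equation sets this
    equal to [f T + w(T) V]; taking the component along
    [cos theta T - sin theta N] eliminates the unknown [w(T)] and leaves the
    ordinary differential equation
      [theta' = kappa + f cos theta]
    ([angle_ode]).  When [kappa = cos theta] it separates,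
    [theta' / cos theta = 1 + f].  Since [kappa > 0], the primitive
    [ln ((1 + sin) / cos)] of [1 / cos], the inverse Gudermannian function, is
    defined along the curve.  Hence [F s := arcgd (theta s) - s] is an
    antiderivative of [f], and [sech \o arcgd = cos] ([sech_arcgd]) turns
    [s + F s = arcgd (theta s)] into [kappa s = sech (s + F s)].

    All derivatives are limits of difference quotients restricted to a subset
    of the line, so the calculus used above (Leibniz rule, chain rule,
    uniqueness of limits) is established for those.  Covariant derivatives are
    computed in a chart, whose domain the curve may leave; continuity of the
    curve makes derivatives within the interval and within the times spent in
    the chart domain agree ([is_deriv_within_times]). *)

(** * Derivatives within a set *)

Section DerivativeWithin.
Context {R : realType}.
Implicit Types (V : normedModType R) (A B : set R) (s : R).

(** Derivatives within a set are local: they only see its germ at the point. *)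
Lemma increments_within_eq A B s : (\forall x \near s, A x <-> B x) ->
  within [set h | A (s + h)] 0^' = within [set h | B (s + h)] 0^'.
Proof.
move=> AB.
have sh : s + h @[h --> (0 : R)^'] --> s.
  rewrite -[X in _ --> X]addr0.
  apply: cvgD; first exact: cvg_cst.
  exact: (@cvg_within _ (nbhs (0 : R))).
have {}AB : \forall h \near (0 : R)^', A (s + h) <-> B (s + h) := sh _ AB.
by apply/seteqP; split => P; apply: filterS2 AB => h AB PP /AB /PP.
Qed.

(** Every point of a nondegenerate interval is an accumulation point of it;
    this is what makes derivatives within the interval unique. *)
Lemma increments_within_proper A s : nondegenerate_interval A -> A s ->
  ProperFilter (within [set h | A (s + h)] 0^').
Proof.
move=> [Ai [a [b [Aa Ab ab]]]] As; split; last exact: within_filter.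
rewrite /within /= => /nbhs_ballP[e /= e0 /(_ _ _ _)] eE.
(* The witness is an increment towards an endpoint different from s, of length
   both small enough for the ball and for staying between the endpoints. *)
have [sb|bs] := ltP s b.
- have d0 : 0 < Num.min (e / 2) (b - s) by rewrite lt_min divr_gt0//= subr_gt0.
  set d := Num.min _ _ in d0.
  have de : d < e.
    apply: (@le_lt_trans _ _ (e / 2)); first by rewrite /d ge_min lexx.
    by move: (e0 : 0 < e); lra.
  have db : d <= b - s by rewrite /d ge_min lexx orbT.
  apply: (eE d) => /=.
  + by rewrite /ball /= sub0r normrN gtr0_norm.
  + by rewrite gt_eqF.
  + by apply: (Ai s b) => //; lra.
- have d0 : 0 < Num.min (e / 2) (s - a).
    by rewrite lt_min divr_gt0//= subr_gt0 (lt_le_trans ab).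
  set d := Num.min _ _ in d0.
  have de : d < e.
    apply: (@le_lt_trans _ _ (e / 2)); first by rewrite /d ge_min lexx.
    by move: (e0 : 0 < e); lra.
  have db : d <= s - a by rewrite /d ge_min lexx orbT.
  apply: (eE (- d)) => /=.
  + by rewrite /ball /= sub0r opprK gtr0_norm.
  + by rewrite oppr_eq0 gt_eqF.
  + by apply: (Ai a s) => //; lra.
Qed.

Lemma is_deriv_within_eq V A (f : R -> V) s l :
  nondegenerate_interval A -> A s ->
  is_deriv_within A f s l -> deriv_within A f s = l.
Proof.
move=> Ai As fl; have := increments_within_proper Ai As => PF.
exact: cvg_lim.
Qed.

Lemma eq_is_deriv_within V A (f g : R -> V) s l : A s ->
  (forall x, A x -> f x = g x) ->
  is_deriv_within A f s l -> is_deriv_within A g s l.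
Proof.
move=> As fg; apply: cvg_trans; apply: near_eq_cvg.
by rewrite near_withinE; near=> h => /= Ah; rewrite !fg.
Unshelve. all: by end_near.
Qed.

(** Differentiability implies continuity, in terms of increments. *)
Lemma is_deriv_within_cvg V A (f : R -> V) s l : is_deriv_within A f s l ->
  f (s + h) @[h --> within [set h | A (s + h)] 0^'] --> f s.
Proof.
move=> fl.
have h0 : h @[h --> within [set h | A (s + h)] (0 : R)^'] --> (0 : R).
  apply: cvg_trans _ (@cvg_within _ (nbhs (0 : R)) _ [set x | x != 0]).
  exact: cvg_within.
(* f (s + h) = h * (difference quotient) + f s tends to 0 * l + f s. *)
rewrite -[X in _ --> X]add0r -(scale0r l).
apply: cvg_trans _ (cvgD (cvgZ h0 fl) (cvg_cst (f s))); apply: near_eq_cvg.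
rewrite near_withinE; near=> h => /= _.
rewrite /GRing.add_fun /= fctE scalerA divff ?scale1r ?subrK//.
by near: h; exact: nbhs_dnbhs_neq.
Unshelve. all: by end_near.
Qed.

Lemma is_deriv_withinD V A (f g : R -> V) s l m :
  is_deriv_within A f s l -> is_deriv_within A g s m ->
  is_deriv_within A (fun x => f x + g x) s (l + m).
Proof.
move=> fl gm; apply: cvg_trans _ (cvgD fl gm); apply: near_eq_cvg.
by near=> h; rewrite fctE -scalerDr opprD addrACA.
Unshelve. all: by end_near.
Qed.

Lemma is_deriv_withinZ V A (a : R -> R) (f : R -> V) s l m :
  is_deriv_within A a s l -> is_deriv_within A f s m ->
  is_deriv_within A (fun x => a x *: f x) s (l *: f s + a s *: m).
Proof.
move=> al fm.
apply: cvg_trans _ (cvgD (cvgZ al (cvg_cst (f s)))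
                       (cvgZ (is_deriv_within_cvg al) fm)).
apply: near_eq_cvg; near=> h; rewrite !fctE -(scalerA _ (_ - a s)).
rewrite (scalerA (a (s + h))) (mulrC (a _)) -scalerA -scalerDr.
rewrite scalerBl scalerBr.
by congr (_ *: _); rewrite addrC addrA subrK.
Unshelve. all: by end_near.
Qed.

(** Caratheodory's form of the derivative of the outer function avoids dividing
    by increments of the inner function, which may vanish. *)
Lemma is_deriv_within_comp A (u G : R -> R) s l m :
  is_deriv_within A u s l -> is_derive (u s) 1 G m ->
  is_deriv_within A (G \o u) s (m * l).
Proof.
move=> ul /is_derive1_caratheodory[q [Gq qc qm]].
have qu : q (u (s + h)) @[h --> within [set h | A (s + h)] 0^'] --> m.
  by rewrite -qm; exact: (cvg_comp _ _ (is_deriv_within_cvg ul) qc).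
apply: cvg_trans _ (cvgM qu ul); apply: near_eq_cvg.
by near=> h => /=; rewrite Gq scalerAr.
Unshelve. all: by end_near.
Qed.

Lemma is_deriv_within_opp A s : is_deriv_within A (fun x : R => - x) s (-1).
Proof.
apply: cvg_near_cst; rewrite near_withinE; near=> h => /= _.
rewrite opprK opprD addrAC addNr add0r scalerN; congr (- _).
by apply: mulVf; near: h; exact: nbhs_dnbhs_neq.
Unshelve. all: by end_near.
Qed.

End DerivativeWithin.

(** * Covariant differentiation along a curve *)

Section CovariantDerivative.
Context {R : realType} {M : topologicalType} {S : atlas R M}.
Context (g : riemannian_metric S) (I : set R) (gamma : R -> M).
Context (I_interval : nondegenerate_interval I).
Context (gamma_smooth : smooth_curve S I gamma).

(** Chart domains are open, so a continuous curve stays in one for a while. *)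
Lemma times_near (c : chart S) s : times I gamma c s ->
  \forall x \near s, times I gamma c x <-> I x.
Proof.
move=> [Is cs]; have [gc _] := gamma_smooth.
have := (subspace_continuousP I gamma).1 gc s Is (dom c).
move=> /(_ (open_nbhs_nbhs (conj (dom_open c) cs))) gdom.
have {}gdom : \forall x \near s, I x -> dom c (gamma x) := gdom.
apply: filterS gdom => x xI; split=> [[]//|Ix].
by split=> //; exact: xI.
Qed.

Lemma is_deriv_within_times (V : normedModType R) (c : chart S) (u : R -> V)
    s l :
  times I gamma c s ->
  is_deriv_within (times I gamma c) u s l <-> is_deriv_within I u s l.
Proof.
by move=> cs; rewrite /is_deriv_within (increments_within_eq (times_near cs)).
Qed.

Lemma is_deriv_within_component (X : along S) (c : chart S) s :
  smooth_within (times I gamma c) (X c) -> times I gamma c s ->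
  is_deriv_within I (X c) s (deriv_within I (X c) s).
Proof.
move=> /(_ 1%N)[dX _] cs.
exact: cvgP ((is_deriv_within_times _ _ cs).1 (dX _ cs)).
Qed.

(** The velocity is defined with derivatives within the whole interval, while
    smoothness of the curve in a chart speaks of derivatives within the times
    spent there. *)
Lemma is_deriv_within_velocity (c : chart S) s : times I gamma c s ->
  is_deriv_within I (velocity I gamma c) s
    (deriv_within I (velocity I gamma c) s).
Proof.
move=> cs; have [_ /(_ c 2%N)[_ [/(_ _ cs) d _]]] := gamma_smooth.
apply: cvgP; apply: (is_deriv_within_times _ _ cs).1.
apply: eq_is_deriv_within cs _ d => x cx.
by rewrite /velocity /deriv_within (increments_within_eq (times_near cx)).
Qed.

(** Leibniz rule for the covariant derivative: the Christoffel term is linear in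
    the field, so only the derivatives of the components matter. *)
Lemma nabla_lincomb (X Y Z : along S) (a b : R -> R) (a' b' : R)
    (c : chart S) s : times I gamma c s ->
  is_deriv_within I (X c) s (deriv_within I (X c) s) ->
  is_deriv_within I (Y c) s (deriv_within I (Y c) s) ->
  is_deriv_within I a s a' -> is_deriv_within I b s b' ->
  (forall x, times I gamma c x -> Z c x = a x *: X c x + b x *: Y c x) ->
  nabla g I gamma Z c s =
    (a' *: X c s + a s *: nabla g I gamma X c s) +
    (b' *: Y c s + b s *: nabla g I gamma Y c s).
Proof.
move=> cs dX dY da db ZE; have [Is _] := cs.
have dZ := is_deriv_withinD (is_deriv_withinZ da dX) (is_deriv_withinZ db dY).
have {}dZ : is_deriv_within I (Z c) s
    (a' *: X c s + a s *: deriv_within I (X c) s +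
     (b' *: Y c s + b s *: deriv_within I (Y c) s)).
  apply/(is_deriv_within_times _ _ cs).
  apply: eq_is_deriv_within (cs) _ ((is_deriv_within_times _ _ cs).2 dZ).
  by move=> x /ZE.
rewrite /nabla (is_deriv_within_eq I_interval Is dZ).
apply/rowP => k; rewrite !mxE (ZE _ cs) !big_ord_recl !big_ord0 !mxE; ring.
Qed.

End CovariantDerivative.

(** * The inverse Gudermannian function *)

Section InverseGudermannian.
Context {R : realType}.
Implicit Types t : R.

Definition arcgd t := ln (1 + sin t) - ln (cos t).

Lemma addr1_sin_gt0 t : 0 < cos t -> 0 < 1 + sin t.
Proof. by have := cos2Dsin2 t; nra. Qed.

Lemma sech_arcgd t : 0 < cos t -> sech (arcgd t) = cos t.
Proof.
move=> c0; have s0 := addr1_sin_gt0 c0; have := sin2cos2 t.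
rewrite /sech /arcgd expRN expRB !lnK ?posrE// => cs.
have -> : (1 + sin t) / cos t + ((1 + sin t) / cos t)^-1 = 2 / cos t.
  have /negbT s1 := gt_eqF s0; have /negbT c1 := gt_eqF c0.
  by field: cs; rewrite c1 s1.
by rewrite invf_div mulrC divfK// pnatr_eq0.
Qed.

Lemma is_derive_arcgd t : 0 < cos t -> is_derive t 1 arcgd (cos t)^-1.
Proof.
move=> c0; have s0 := addr1_sin_gt0 c0; have cs := sin2cos2 t.
have ds :
    is_derive t 1 (fun x : R => ln (1 + sin x)) ((1 + sin t)^-1 * cos t).
  have := is_derive1_ln s0 => ?; apply: is_derive1_comp.
  rewrite -[cos t]add0r.
  exact: is_deriveD (is_derive_cst _ _ _) (is_derive_sin t).
have dc : is_derive t 1 (fun x : R => ln (cos x)) ((cos t)^-1 * - sin t).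
  by have := is_derive1_ln c0 => ?; apply: is_derive1_comp.
have := is_deriveB ds dc => darc; apply: is_derive_eq darc _.
have /negbT s1 := gt_eqF s0; have /negbT c1 := gt_eqF c0.
by field: cs; rewrite c1 s1.
Qed.

End InverseGudermannian.

(** * The differential equation of the angle *)

Section FrameComponents.
Context {R : realType} {M : topologicalType} {S : atlas R M}.
Context (g : riemannian_metric S) (gamma : R -> M).

Lemma orthonormal_coords (X Y : along S) (c : chart S) s (a b : R) :
  inner g gamma c s X X = 1 -> inner g gamma c s X Y = 0 ->
  inner g gamma c s Y Y = 1 ->
  a *: X c s + b *: Y c s = 0 -> a = 0 /\ b = 0.
Proof.
rewrite /inner => XX XY YY ab0.
have a0 : a = 0.
  have := congr1
    (fun v => (X c s *m metric g c (coord c (gamma s)) *m v^T) 0 0) ab0.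
  rewrite !linearD !linearZ /= trmx0 mulmx0.
  by rewrite mxE [X in X + _ = _]mxE [X in _ + X = _]mxE XX XY !mxE; lra.
split=> //.
have := congr1
  (fun v => (Y c s *m metric g c (coord c (gamma s)) *m v^T) 0 0) ab0.
by rewrite a0 scale0r add0r !linearZ /= trmx0 mulmx0 mxE YY mxE; lra.
Qed.

End FrameComponents.

(** Comparing the [T] and [N] components of [nabla V = f T + w(T) V], with
    [w(T)] abbreviated to [w'], gives
      [(theta' - kappa) cos theta = f + w' sin theta],
      [- (theta' - kappa) sin theta = w' cos theta];
    [cos theta] times the former minus [sin theta] times the latter is free of
    [w']. *)
Lemma angle_ode (R : realType) (M : topologicalType) (S : atlas R M)
    (g : riemannian_metric S) (o : orientation S) (I : set R) (gamma : R -> M)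
    (N V : along S) (kappa theta f : R -> R) (w : form_along S) :
  nondegenerate_interval I -> smooth_curve S I gamma ->
  frenet_frame g o I gamma N kappa ->
  (forall s, I s -> derivable_within I theta s) ->
  (forall c s, times I gamma c s ->
     V c s = sin (theta s) *: velocity I gamma c s + cos (theta s) *: N c s) ->
  torse_forming g I gamma V f w ->
  forall s, I s ->
    is_deriv_within I theta s (kappa s + f s * cos (theta s)).
Proof.
move=> I_interval gs [[Nsm _] orth _ _ frenet] dtheta VE.
move=> [_ _ _ torse] s Is.
have dth : is_deriv_within I theta s (deriv_within I theta s) := dtheta s Is.
have [c cp] := dom_cover S (gamma s).
have cs : times I gamma c s by [].
have [TT NN TN] := orth c s cs; have [nT nN] := frenet c s cs.
have dT := is_deriv_within_velocity gs cs.
have dN := is_deriv_within_component gs (Nsm c) cs.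
have dsin := is_deriv_within_comp dth (is_derive_sin (theta s)).
have dcos := is_deriv_within_comp dth (is_derive_cos (theta s)).
have nV := nabla_lincomb g I_interval gs cs dT dN dsin dcos (VE c).
move: nV; rewrite (torse c s cs) (VE c s cs) nT nN => nV.
set w' := eval_form _ _ _ _ in nV.
set t' := deriv_within I theta s in dth nV.
have [] := @orthonormal_coords _ _ _ g gamma (velocity I gamma) N c s
  ((t' - kappa s) * cos (theta s) - f s - w' * sin (theta s))
  (- (t' - kappa s) * sin (theta s) - w' * cos (theta s)) TT TN NN.
  move/esym/eqP: nV; rewrite -subr_eq0 => /eqP nV; rewrite -[RHS]nV.
  apply/rowP => k; rewrite !mxE /=; ring.
set eT := (X in X = 0 -> _); set eN := (X in _ -> X = 0 -> _) => eT0 eN0.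
suff -> : kappa s + f s * cos (theta s) = t' by [].
transitivity (t' - (cos (theta s) * eT - sin (theta s) * eN)).
  have sc := sin2cos2 (theta s).
  by rewrite /eT /eN; ring: sc.
by rewrite eT0 eN0 !mulr0 !subr0.
Qed.

Theorem theorem4p2 (R : realType) (M : topologicalType) (S : atlas R M)
    (M_hausdorff : hausdorff_space M) (M_countable : @second_countable M)
    (M_connected : connected [set: M])
    (g : riemannian_metric S) (o : orientation S)
    (I : set R) (I_interval : nondegenerate_interval I)
    (gamma : R -> M) (N V : along S) (kappa theta f : R -> R)
    (w : form_along S)
    (frame : frenet_frame g o I gamma N kappa)
    (PA : PA_curve g I gamma N V theta)
    (V_eq : forall c s, times I gamma c s ->
       V c s = sin (theta s) *: velocity I gamma c s + cos (theta s) *: N c s)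
    (V_torse : torse_forming g I gamma V f w)
    (V_not_parallel : ~ parallel_along g I gamma V)
    (theta_kappa : forall s, I s -> cos (theta s) = kappa s) :
  exists F : R -> R,
    (forall s, I s -> is_deriv_within I F s (f s)) /\
    (forall s, I s -> kappa s = sech (s + F s)).
Proof.
have [[[gs _] _] _ [th_smooth _] _ _] := PA; have [_ _ _ kappa_gt0 _] := frame.
have cos_gt0 s : I s -> 0 < cos (theta s).
  by move=> Is; rewrite theta_kappa// kappa_gt0.
exists (fun s => arcgd (theta s) - s); split=> s Is; last first.
  by rewrite addrC subrK sech_arcgd ?cos_gt0 ?theta_kappa.
have dth :=
  angle_ode I_interval gs frame (th_smooth 1%N).1 V_eq V_torse Is.
have dgd := is_deriv_within_comp dth (is_derive_arcgd (cos_gt0 s Is)).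
have -> : f s = (cos (theta s))^-1 * (kappa s + f s * cos (theta s)) + - 1.
  have k0 := kappa_gt0 s Is; rewrite theta_kappa//; have /negbT k1 := gt_eqF k0.
  by field.
exact: is_deriv_withinD dgd (is_deriv_within_opp _ _).
Qed.
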